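(* Let $N \ge 2$ be an integer and let $\{\theta_n\}_{n=0}^{N-1}$ be real numbers such that $\theta_0 \equiv \frac{\pi}{4} \bmod 2\pi$ or $\theta_0 \equiv \frac{5\pi}{4} \bmod 2\pi$, and $\theta_n + \theta_{N-n} \equiv \frac{\pi}{2} \bmod 2\pi$ for every $n \in \{1,2,\ldots,N-1\}$. Define $$a_k = \frac{\sqrt{2}}{N}\sum_{n=0}^{N-1}\cos\left(\frac{2\pi n}{N}(k-1)+\theta_n\right) \quad\text{for } k \in \{1,2,\ldots,N\}.$$ Then $(a_1, a_2, \ldots, a_N)$ is a cog in $\mathbb{R}^N$.
   Context: For an integer $n$, let $(n)^*$ denote the unique element of $\{1,2,\ldots,N\}$ congruent to $n$ modulo $N$. The cyclic companions of a vector $(a_1,\ldots,a_N)\in\mathbb{R}^N$ are its cyclic shifts $\left(a_{(1+s)^*}, a_{(2+s)^*}, \ldots, a_{(N+s)^*}\right)$, $s\in\{1,\ldots,N-1\}$. A vector $(a_1,\ldots,a_N)\in\mathbb{R}^N$ is called a cyclic orthonormal generator (cog) in $\mathbb{R}^N$ if it together with its cyclic companions forms an orthonormal basis of $\mathbb{R}^N$ (standard inner product); equivalently, $\sum_{j=1}^{N} a_j a_{(j+s)^*} = \delta_0^s$ for every $s\in\{0,1,\ldots,N-1\}$, where $\delta_0^s = 1$ if $s=0$ and $0$ otherwise. For real $x,y$, $x\equiv y \bmod 2\pi$ means $x-y\in 2\pi\mathbb{Z}$. *)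

(* Defs.v *)
From HB Require Import structures.
From mathcomp Require Import all_boot all_order all_algebra.
From mathcomp Require Import sesquilinear.
From mathcomp Require Import reals trigo.

Set Implicit Arguments.
Unset Strict Implicit.
Unset Printing Implicit Defensive.

Import Order.TTheory GRing.Theory Num.Theory.
Local Open Scope ring_scope.

Section StandardDotProduct.
Variables (R : realType) (n : nat).
Implicit Types u v : 'rV[R]_n.

Definition dotv u v : R := \sum_(i < n) u 0 i * v 0 i.

(* The structures below let the library's [orthonormal] apply to [dotv]. *)
Fact dotv_is_bilinear :
  bilinear_for *%R (idfun \; *%R) (dotv : 'rV[R]_n -> 'rV[R]_n -> R).
Proof.
split=> u a x y; rewrite /dotv /= mulr_sumr -big_split /=.
  by apply: eq_bigr => i _; rewrite !mxE mulrDl mulrA.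
by apply: eq_bigr => i _; rewrite !mxE mulrDr mulrCA.
Qed.

HB.instance Definition _ :=
  bilinear_isBilinear.Build R 'rV[R]_n 'rV[R]_n R *%R (idfun \; *%R) dotv
    dotv_is_bilinear.

Fact dotv_sym u v : dotv u v = (-1) ^+ false * idfun (dotv v u).
Proof. by rewrite expr0 mul1r; apply: eq_bigr => i _; rewrite mulrC. Qed.

HB.instance Definition _ :=
  isHermitianSesquilinear.Build R 'rV[R]_n false idfun dotv dotv_sym.

Fact dotv_gt0 u : u != 0 -> 0 < dotv u u.
Proof.
move=> u0; rewrite lt_def sumr_ge0 ?andbT; last first.
  by move=> i _; rewrite -expr2 sqr_ge0.
apply: contra u0; rewrite psumr_eq0; last first.
  by move=> i _; rewrite -expr2 sqr_ge0.
move=> /allP u0; apply/eqP/rowP => i; rewrite mxE; apply/eqP.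
by have := u0 i (mem_index_enum _); rewrite mulf_eq0 orbb.
Qed.

HB.instance Definition _ := isDotProduct.Build R 'rV[R]_n dotv dotv_gt0.

End StandardDotProduct.

Section CyclicOrthonormalGenerator.
Variables (R : realType) (N : nat).
Implicit Types a : 'rV[R]_N.

Fact ord_add_subproof (s : nat) (i : 'I_N) : ((i + s) %% N < N)%N.
Proof. exact: ltn_pmod (leq_ltn_trans (leq0n i) (ltn_ord i)). Qed.

Definition ord_add (s : nat) (i : 'I_N) : 'I_N :=
  Ordinal (ord_add_subproof s i).

(* A vector (a_1, ..., a_N) is the row whose entry at [i : 'I_N] is
   a_{i+1}; since (i + 1 + s)^* - 1 = (i + s) %% N, this is the cyclic shift
   (a_{(1+s)^*}, ..., a_{(N+s)^*}). *)
Definition cyclic_shift (s : nat) a : 'rV[R]_N :=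
  \row_(i < N) a 0 (ord_add s i).

Definition cyclic_companions a : seq 'rV[R]_N :=
  [seq cyclic_shift s a | s <- iota 1 N.-1].

Definition orthonormal_basis (X : seq 'rV[R]_N) : bool :=
  orthonormal (@dotv R N) X && basis_of fullv X.

Definition cog a : bool := orthonormal_basis (a :: cyclic_companions a).

End CyclicOrthonormalGenerator.

Definition eqmod_2pi (R : realType) (x y : R) : Prop :=
  exists k : int, x - y = 2 * pi * k%:~R.

(* Main.v *)
(** Writing [w = 2 pi / N], product-to-sum turns the correlation of the shifts
    by [s] and [t] into a sum over frequencies [n], [m] of
    [cos (w (n + m) j + ...)] and [cos (w (n - m) j + ...)].  Summing over [j]
    leaves only [m = - n] and [m = n] modulo [N].  The phases of the first kind
    add up to [pi / 2] and those of the second kind cancel, so the correlation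
    is the mean over [m] of
    [cos (w m (t - s) + pi / 2) + cos (w m (t - s))],
    which is 1 if [s = t] modulo [N] and 0 otherwise. *)

Require Import Defs.
From mathcomp Require Import all_boot all_order all_algebra.
From mathcomp Require Import sesquilinear zify ring.
From mathcomp Require Import reals trigo.
Import Order.TTheory GRing.Theory Num.Theory.
Local Open Scope ring_scope.

Section CosineSums.
Context {R : realType}.
Implicit Types (x y c : R) (k p : int).

Lemma cosD2piz x k : cos (x + 2 * pi * k%:~R) = cos x.
Proof.
have perD (m : nat) (z : R) : cos (z + 2 * pi * m%:R) = cos z.
  by rewrite -[RHS](periodicn (@cosD2pi R) m); congr (cos (z + _)); ring.
case: k => m; first exact: perD.
by rewrite NegzE -[LHS](perD m.+1) mulrNz mulrN subrK.
Qed.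

Lemma cos_eqmod_2pi {x y} : eqmod_2pi x y -> cos x = cos y.
Proof. by case=> k xy; rewrite -(cosD2piz y k) -xy addrC subrK. Qed.

Lemma eqmod_2piD2l c {x y} : eqmod_2pi x y -> eqmod_2pi (c + x) (c + y).
Proof. by case=> k xy; exists k; rewrite -xy; ring. Qed.

Lemma mulr2cos x y : 2 * (cos x * cos y) = cos (x + y) + cos (x - y).
Proof. by rewrite cosD cosB; ring. Qed.

(** Each term [2 * sin (x / 2) * cos (x * j + c)] is the difference of [sin (x * j - x / 2 + c)] at
    [j + 1] and at [j]. *)
Lemma telescope_sum_cos x c (N : nat) :
  2 * sin (x / 2) * \sum_(j < N) cos (x * j%:R + c) =
  sin (x * N%:R - x / 2 + c) - sin (c - x / 2).
Proof.
rewrite mulr_sumr -(big_mkord xpredT (fun j => _ * cos (x * j%:R + c))).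
rewrite (telescope_sumr_eq (fun j => sin (x * j%:R - x / 2 + c))) //.
  by rewrite mulr0 add0r [- _ + c]addrC.
move=> j _.
have -> : x * j.+1%:R - x / 2 + c = (x * j%:R + c) + x / 2.
  by rewrite -natr1; field.
have -> : x * j%:R - x / 2 + c = (x * j%:R + c) - x / 2 by ring.
by rewrite sinD sinB; ring.
Qed.

(** Only the residue [r] of [p] modulo [N] matters. If [r = 0], the summands are constant; otherwise
    the endpoints of the telescoped sum differ by [r] full periods. *)
Lemma sum_cos (N : nat) p c : (0 < N)%N ->
  \sum_(j < N) cos (2 * pi * p%:~R / N%:R * j%:R + c) =
  (N%:Z %| p)%Z%:R * (N%:R * cos c).
Proof.
move=> N0; have NR0 : N%:R != 0 :> R by rewrite pnatr_eq0 -lt0n.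
have NZ0 : 0 < N%:Z by [].
pose r := `|(p %% N%:Z)%Z|%N.
have rE : r%:Z = (p %% N%:Z)%Z by rewrite /r gez0_abs ?modz_ge0 ?gt_eqF.
have rN : (r < N)%N by rewrite -ltz_nat rE ltz_pmod.
have pE : p%:~R = (p %/ N%:Z)%Z%:~R * N%:R + r%:R :> R.
  by rewrite [in LHS](divz_eq p N%:Z) -rE rmorphD rmorphM.
transitivity (\sum_(j < N) cos (2 * pi * r%:R / N%:R * j%:R + c)).
  apply: eq_bigr => j _; apply: cos_eqmod_2pi.
  exists ((p %/ N%:Z)%Z * j%:Z); rewrite pE rmorphM /=; field.
  exact: NR0.
have -> : (N%:Z %| p)%Z = (r == 0%N) by rewrite -eqz_nat rE; apply/dvdz_mod0P/eqP.
have [->|r0] := eqVneq r 0%N.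
  rewrite mul1r (eq_bigr (fun=> cos c)); last first.
    by move=> j _; rewrite mulr0 !mul0r add0r.
  by rewrite sumr_const card_ord mulr_natl.
rewrite mul0r; set x := 2 * pi * r%:R / N%:R.
(* Since [0 < r < N], the angle [x / 2 = pi * r / N] lies strictly between [0] and [pi], so this
   factor can be cancelled. *)
have sx : 0 < sin (x / 2).
  apply: sin_gt0_pi.
  have -> : x / 2 = pi * (r%:R / N%:R) by rewrite /x; field.
  rewrite mulr_gt0 ?pi_gt0 ?divr_gt0 ?ltr0n // ?lt0n //=.
  by rewrite gtr_pMr ?pi_gt0 // ltr_pdivrMr ?ltr0n // mul1r ltr_nat.
have sx2 : 2 * sin (x / 2) != 0 by rewrite mulf_neq0 ?(gt_eqF sx) ?pnatr_eq0.
apply: (mulfI sx2).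
rewrite telescope_sum_cos mulr0.
have -> : x * N%:R - x / 2 + c = c - x / 2 + (pi *+ 2) *+ r.
  by rewrite -mulr_natr -[pi *+ 2]mulr_natr /x; field.
by rewrite (periodicn (@sinD2pi R)) subrr.
Qed.

End CosineSums.

Section RealOrthonormal.
Context {R : realType} {N : nat}.

Lemma orthonormal_map (v : nat -> 'rV[R]_N) (r : seq nat) : uniq r ->
  {in r &, forall s t, dotv (v s) (v t) = (s == t)%:R} ->
  orthonormal (@dotv R N) (map v r).
Proof.
move=> ur vr; apply/andP; split.
  by rewrite all_map; apply/allP => s sr /=; rewrite vr ?eqxx.
elim: r ur vr => //= s r IHr /andP[sr ur] vr; rewrite IHr ?andbT //; last first.
  by move=> t t' tr t'r; rewrite vr // inE ?tr ?t'r orbT.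
rewrite all_map; apply/allP => t tr /=.
rewrite vr ?mem_head ?inE ?tr ?orbT //.
by have [st|//] := eqVneq s t; rewrite st tr in sr.
Qed.

(* The library's [orthonormal_free] is restricted to [numClosedFieldType]. *)
Lemma orthonormal_basis_mkseq (v : nat -> 'rV[R]_N) :
  (forall s t, (s < N)%N -> (t < N)%N -> dotv (v s) (v t) = (s == t)%:R) ->
  orthonormal_basis (mkseq v N).
Proof.
move=> vE; apply/andP; split.
  apply: orthonormal_map; first exact: iota_uniq.
  by move=> s t; rewrite !mem_iota; apply: vE.
(* The family has as many members as the dimension, so only freeness remains. *)
rewrite basisEfree subvf size_mkseq dimvf dim_matrix mul1r leqnn !andbT.
pose X := [tuple v i | i < N].
have -> : mkseq v N = X by rewrite /mkseq -val_enum_ord -map_comp.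
apply/freeP => k k0 i.
have XE (j : 'I_N) : X`_j = v j by rewrite -tnth_nth tnth_mktuple.
(* Pairing the vanishing combination with [v i] isolates its coefficient [k i]. *)
have := linear0r (@dotv R N) (v i).
rewrite -k0 linear_sumr (bigD1 i) //= big1 ?addr0; last first.
  by move=> j ji; rewrite linearZr_LR /= XE vE // eq_sym val_eqE (negPf ji) mulr0.
by rewrite linearZr_LR /= XE vE // eqxx mulr1.
Qed.

End RealOrthonormal.

Section Correlation.
Context {R : realType} (N : nat) (theta : nat -> R).
Hypothesis N_gt0 : (0 < N)%N.
(** The case [n = m = 0] says that [2 * theta 0] is [pi / 2] modulo [2 * pi], which merges the two
    admissible values of [theta 0]. *)
Hypothesis theta_opp : forall n m : nat, (n < N)%N -> (m < N)%N ->
  (N %| n + m)%N -> eqmod_2pi (theta n + theta m) (pi / 2).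

Definition freq : R := 2 * pi / N%:R.
(** This is [a_{k+1}], extended periodically to every natural [k], so that cyclic shifts become
    plain translations. *)
Definition cog_coord (k : nat) : R :=
  Num.sqrt 2 / N%:R * \sum_(n < N) cos (freq * n%:R * k%:R + theta n).

Let N_neq0 : N%:R != 0 :> R. Proof. by rewrite pnatr_eq0 -lt0n. Qed.

Lemma cog_coord_mod k : cog_coord (k %% N) = cog_coord k.
Proof.
congr (_ * _); apply: eq_bigr => n _; apply: cos_eqmod_2pi.
exists (- (n * (k %/ N))%N%:Z).
rewrite {2}(divn_eq k N) rmorphN /= -pmulrn !natrM natrD natrM /freq; field.
exact: N_neq0.
Qed.

Lemma cog_coord_correlation (s t : nat) : (s < N)%N -> (t < N)%N ->
  \sum_(j < N) cog_coord (j + s) * cog_coord (j + t) = (s == t)%:R.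
Proof.
move=> sN tN.
pose A (n s j : nat) := freq * n%:R * (j + s)%:R + theta n.
pose d : R := t%:R - s%:R.
have sumA (n m : 'I_N) : \sum_(j < N) 2 * (cos (A n s j) * cos (A m t j)) =
    (N %| n + m)%:R * (N%:R * cos (freq * d * m%:R + pi / 2)) +
    (n == m)%:R * (N%:R * cos (freq * d * m%:R)).
  under eq_bigr do rewrite mulr2cos; rewrite big_split; congr (_ + _).
    have -> : (N %| n + m)%N = (N%:Z %| (n + m)%N%:Z)%Z by [].
    rewrite (eq_bigr (fun j : 'I_N =>
        cos (2 * pi * (n + m)%N%:Z%:~R / N%:R * j%:R +
             (freq * (n%:R * s%:R + m%:R * t%:R) + (theta n + theta m))))).
      rewrite sum_cos //; case: (boolP (N%:Z %| _)%Z) => [|_]; last by rewrite !mul0r.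
      move=> Nnm; congr (_ * (_ * _)).
      rewrite (cos_eqmod_2pi (eqmod_2piD2l _ (theta_opp n m _ _ Nnm))) //.
      have /dvdnP[q nmE] : (N %| n + m)%N := Nnm.
      (* Substituting [n = q * N - m] leaves the phase [freq * d * m] plus [2 * pi * (q * s)]. *)
      apply: cos_eqmod_2pi; exists (q * s)%N%:Z.
      have nE : n%:R = q%:R * N%:R - m%:R :> R by rewrite -natrM -nmE natrD addrK.
      rewrite -pmulrn natrM nE /freq /d; field.
      exact: N_neq0.
    by move=> j _; congr cos; rewrite -pmulrn /A !natrD /freq; field; exact: N_neq0.
  rewrite (eq_bigr (fun j : 'I_N =>
      cos (2 * pi * (n%:Z - m%:Z)%:~R / N%:R * j%:R +
           (freq * (n%:R * s%:R - m%:R * t%:R) + (theta n - theta m))))).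
    rewrite sum_cos //.
    have -> : (N%:Z %| n%:Z - m%:Z)%Z = (n == m).
      by rewrite -eqz_mod_dvd !modz_nat eqz_nat !modn_small.
    have [->|] := eqVneq n m; last by rewrite !mul0r.
    (* For [n = m] the phase is the opposite of [freq * d * m]; cosine is even. *)
    by congr (_ * (_ * _)); rewrite -cosN; congr cos; rewrite /d; ring.
  move=> j _; congr cos; rewrite rmorphB /= -!pmulrn /A !natrD /freq; field.
  exact: N_neq0.
(* Here [sum_cos] is applied over frequencies instead of positions, with [p = t - s]. *)
have sumd c : \sum_(m < N) cos (freq * d * m%:R + c) = (s == t)%:R * (N%:R * cos c).
  have -> : (s == t) = (N%:Z %| t%:Z - s%:Z)%Z.
    by rewrite -eqz_mod_dvd !modz_nat eqz_nat !modn_small // eq_sym.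
  rewrite -sum_cos //; apply: eq_bigr => m _; congr cos.
  by rewrite rmorphB /= -!pmulrn /freq /d; field; exact: N_neq0.
have sqr_coef :
    Num.sqrt 2 / N%:R * (Num.sqrt 2 / N%:R) = N%:R ^- 2 * 2 :> R.
  by rewrite mulrACA -!expr2 sqr_sqrtr // exprVn mulrC.
transitivity (N%:R ^- 2 *
    \sum_(n < N) \sum_(m < N) \sum_(j < N) 2 * (cos (A n s j) * cos (A m t j))).
  rewrite (eq_bigr (fun j : 'I_N => N%:R ^- 2 *
      \sum_(n < N) \sum_(m < N) 2 * (cos (A n s j) * cos (A m t j)))).
    rewrite -mulr_sumr exchange_big /=; congr (_ * _).
    by apply: eq_bigr => n _; rewrite exchange_big.
  move=> j _; rewrite /cog_coord mulrACA big_distrlr /= sqr_coef -mulrA; congr (_ * _).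
  by rewrite mulr_sumr; apply: eq_bigr => n _; rewrite mulr_sumr.
(* The index opposite to [m] modulo [N]; the reduction matters for [m = 0]. *)
have opp_lt (m : 'I_N) : ((N - m) %% N < N)%N by rewrite ltn_mod.
have dvd_opp (n m : 'I_N) : (N %| n + m)%N = (n == Ordinal (opp_lt m)).
  rewrite -val_eqE /= -[X in _ = (X == _)](modn_small (ltn_ord n)).
  by rewrite -(eqn_modDr m) subnK ?modnn // ltnW.
have sum_delta (i : 'I_N) (x : R) : \sum_(n < N) (n == i)%:R * x = x.
  rewrite (bigD1 i) //= eqxx mul1r big1 ?addr0 // => n /negPf ->.
  by rewrite mul0r.
(* For fixed [m], each delta selects a single [n]. The added [0] gives both cosines the shape of
   [sumd]. *)
rewrite exchange_big /= (eq_bigr (fun m : 'I_N =>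
    N%:R * (cos (freq * d * m%:R + pi / 2) + cos (freq * d * m%:R + 0)))); last first.
  move=> m _; under eq_bigr do rewrite sumA dvd_opp.
  by rewrite big_split /= !sum_delta -mulrDr [_ + 0]addr0.
rewrite -mulr_sumr big_split /= !sumd cos_pihalf cos0.
by field; exact: N_neq0.
Qed.

End Correlation.

Theorem theorem2 (R : realType) (N : nat) (theta : nat -> R)
  (hN : (2 <= N)%N)
  (htheta0 : eqmod_2pi (theta 0%N) (pi / 4) \/
             eqmod_2pi (theta 0%N) (5 * pi / 4))
  (htheta : forall n : nat, (1 <= n <= N - 1)%N ->
     eqmod_2pi (theta n + theta (N - n)%N) (pi / 2)) :
  cog (\row_(i < N)
    (let k : nat := i.+1 in
     Num.sqrt 2 / N%:R *
       \sum_(0 <= n < N) cos (2 * pi * n%:R / N%:R * (k%:R - 1) + theta n))).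
Proof.
have N0 : (0 < N)%N by exact: ltnW.
have thetaN (n m : nat) : (n < N)%N -> (m < N)%N -> (N %| n + m)%N ->
    eqmod_2pi (theta n + theta m) (pi / 2).
  move=> nN mN /dvdnP[q nm].
  have q_lt2 : (q < 2)%N by rewrite -(ltn_pmul2r N0) -nm; lia.
  have [n0|n_gt0] := posnP n.
    have m0 : m = 0%N by case: q nm q_lt2 => [|[|q]]; lia.
    rewrite n0 m0; case: htheta0 => -[k kE].
      by exists (k + k); rewrite intrD mulrDr -kE; field.
    (* Doubling [5 * pi / 4] gives [pi / 2 + 2 * pi], hence the extra [1]. *)
    by exists (k + k + 1); rewrite 2!intrD 2!mulrDr -kE; field.
  have -> : m = (N - n)%N by case: q nm q_lt2 => [|[|q]]; lia.
  by apply: htheta; lia.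
set v := \row_i _.
have vE i : v 0 i = cog_coord N theta i.
  rewrite mxE big_mkord; congr (_ * _); apply: eq_bigr => n _; congr (cos (_ + _)).
  by rewrite -[i.+1%:R]natr1 addrK /freq; field; rewrite pnatr_eq0 -lt0n.
have shiftE s j : cyclic_shift s v 0 j = cog_coord N theta (j + s).
  by rewrite mxE vE cog_coord_mod.
rewrite /cog.
(* The generator counts as its own shift by [0], so one index [s < N] covers the whole family. *)
have -> : v :: cyclic_companions v = mkseq (fun s => cyclic_shift s v) N.
  rewrite -[N in mkseq _ N](prednK N0) /mkseq /=; congr (_ :: _).
  apply/rowP => i; rewrite [RHS]mxE; congr (fun_of_matrix v _ _).
  by apply: val_inj; rewrite /= addn0 modn_small.
apply: orthonormal_basis_mkseq => s t sN tN.
rewrite -(cog_coord_correlation _ _ N0 thetaN _ _ sN tN); apply: eq_bigr => j _.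
by rewrite !shiftE.
Qed.
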